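(* Let $T$ be a tournament on $n$ vertices. Then $u^{+}(T) \leq u^{-}(T)$. In particular, $u^{+}(T) \leq n - \lfloor\log_2(n)\rfloor$.
   Context: The skew-adjacency matrix of a tournament with vertex set $\{v_1,\ldots,v_n\}$ is the $n\times n$ zero-diagonal matrix $S=[s_{ij}]$ in which $s_{ij}=1$ and $s_{ji}=-1$ if $v_i$ dominates $v_j$. A tournament is unimodular if the determinant of its skew-adjacency matrix is $1$ (by convention the empty tournament has determinant $1$, so it is unimodular). For a tournament $T$ on $n\ge 1$ vertices, $u^{+}(T)$ is the smallest number of vertices that must be added to $T$ to obtain a unimodular tournament, i.e. the smallest $k\ge 0$ such that some unimodular tournament on $n+k$ vertices contains $T$ as an induced subtournament; and $u^{-}(T)$ is the smallest number of vertices that must be removed from $T$ to obtain a unimodular tournament. *)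

(* Defs.v *)
From HB Require Import structures.
From mathcomp Require Import all_boot all_order all_algebra.
Set Implicit Arguments.
Unset Strict Implicit.
Unset Printing Implicit Defensive.
Import GRing.Theory.

Record tournament (n : nat) := Tournament {
  dominates :> rel 'I_n;
  dominates_irr : irreflexive dominates;
  dominates_xor : forall i j, i != j -> dominates i j = ~~ dominates j i
}.

Definition skew_adj (n : nat) (T : tournament n) : 'M[int]_n :=
  (\matrix_(i, j) (if T i j then 1 else if T j i then -1 else 0))%R.

(* For [n = 0] the determinant is [1] ([det_mx00]), which is the usual
   convention for the empty tournament. *)
Definition unimodular (n : nat) (T : tournament n) : Prop :=
  (\det (skew_adj T) = 1)%R.

Section Induced.
Variables (n : nat) (T : tournament n) (A : {set 'I_n}).

Definition induced_rel : rel 'I_#|A| :=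
  fun i j => T (enum_val i) (enum_val j).

Lemma induced_irr : irreflexive induced_rel.
Proof. by move=> i; apply: dominates_irr. Qed.

Lemma induced_xor i j : i != j -> induced_rel i j = ~~ induced_rel j i.
Proof.
by move=> ij; apply: dominates_xor; rewrite (inj_eq enum_val_inj).
Qed.

(* The subtournament on [A], its vertices renumbered by ['I_#|A|]. *)
Definition induced : tournament #|A| := Tournament induced_irr induced_xor.

End Induced.

Definition contains_induced (m n : nat) (U : tournament m) (T : tournament n)
  : Prop :=
  exists2 f : 'I_n -> 'I_m, injective f & forall i j, U (f i) (f j) = T i j.

Definition unimodular_by_adding (n : nat) (T : tournament n) (k : nat) : Prop :=
  exists2 U : tournament (n + k), unimodular U & contains_induced U T.

Definition unimodular_by_removing (n : nat) (T : tournament n) (k : nat)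
  : Prop :=
  exists2 X : {set 'I_n}, #|X| = k & unimodular (induced T (~: X)).

Definition is_least (P : nat -> Prop) (k : nat) : Prop :=
  P k /\ forall j, P j -> k <= j.

(* [u^+(T)] and [u^-(T)] as graphs of functions: a least element is unique, but
   that some [k] is admissible for [u^+] is not immediate. *)
Definition is_u_plus (n : nat) (T : tournament n) : nat -> Prop :=
  is_least (unimodular_by_adding T).

Definition is_u_minus (n : nat) (T : tournament n) : nat -> Prop :=
  is_least (unimodular_by_removing T).

(* Main.v *)
(** Let [H] be a unimodular subtournament of [T], and give every vertex [x]
    outside [H] a twin [x'] with [x -> x'] and otherwise the same neighbours.
    Subtracting the row and column of [x] from those of [x'] leaves only the
    entries [1] and [-1] linking the pair, so the determinant of the enlarged
    tournament is that of [H], and as many vertices were added as [H] misses.  A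
    largest [H] gives [u^+ <= u^-].  The logarithmic bound comes from a
    transitive [H] of even order: transitive tournaments of even order are
    unimodular, and [T] has a transitive subtournament on
    [trunc_log 2 n + 1] vertices. *)
Require Import Defs.
From HB Require Import structures.
From mathcomp Require Import all_boot all_order all_algebra.
From Stdlib Require Import Classical_Prop.
Set Implicit Arguments.
Unset Strict Implicit.
Unset Printing Implicit Defensive.
Import GRing.Theory.

(** Descent by strong induction; excluded middle is used because [P] is an arbitrary, possibly
    undecidable predicate. *)
Lemma is_least_exists (P : nat -> Prop) (k : nat) :
  P k -> exists m, is_least P m.
Proof.
elim/ltn_ind: k => k IH Pk.
case: (classic (exists2 j, j < k & P j)) => [[j ltjk Pj]|none].
  exact: IH Pj.
exists k; split=> // j Pj; rewrite leqNgt; apply/negP => ltjk.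
by apply: none; exists j.
Qed.

(** * Determinants of twinned and of transitive matrices, by block elimination *)

Section Determinants.
Local Open Scope ring_scope.
Variable R : comNzRingType.

(** The two dimensions are kept apart because [P] will be [row_mx F E], whose width [m + k] equals
    [n] only propositionally. *)
Lemma det_congr n p (M : 'M[R]_n) (P : 'M[R]_(n, p)) :
  n = p -> P^T *m P = 1%:M -> \det (P^T *m M *m P) = \det M.
Proof.
move=> enp; case: p / enp P => P PP.
by rewrite !det_mulmx mulrAC -det_mulmx PP det1 mul1r.
Qed.

Lemma det_mulmx_ulblock p q (A : 'M[R]_(q, p)) (M : 'M[R]_(p + q)) :
  \det (block_mx 1%:M 0 A 1%:M *m M) = \det M.
Proof. by rewrite det_mulmx det_lblock !det1 !mul1r. Qed.

Lemma det_mulmx_uublock p q (A : 'M[R]_(p, q)) (M : 'M[R]_(p + q)) :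
  \det (block_mx 1%:M A 0 1%:M *m M) = \det M.
Proof. by rewrite det_mulmx det_ublock !det1 !mul1r. Qed.

Lemma det_mulmxr_ulblock p q (A : 'M[R]_(q, p)) (M : 'M[R]_(p + q)) :
  \det (M *m block_mx 1%:M 0 A 1%:M) = \det M.
Proof. by rewrite det_mulmx det_lblock !det1 !mulr1. Qed.

Lemma det_mulmxr_uublock p q (A : 'M[R]_(p, q)) (M : 'M[R]_(p + q)) :
  \det (M *m block_mx 1%:M A 0 1%:M) = \det M.
Proof. by rewrite det_mulmx det_ublock !det1 !mulr1. Qed.

Definition mulmx_blockE :=
  (mulmx_block, mul1mx, mul0mx, mulmx1, mulmx0, addr0, add0r).

(* The matrix on the left is that of a tournament in which the vertices selected
   by the columns of [E] got twins; the one on the right isolates these vertices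
   with diagonal entries [1], as [E *m E^T] is the projection onto them. *)
Lemma det_twin n k (S : 'M[R]_n) (E : 'M[R]_(n, k)) : E^T *m E = 1%:M ->
  \det (block_mx S (S *m E + E) (E^T *m S - E^T) (E^T *m S *m E)) =
  \det ((1%:M - E *m E^T) *m S *m (1%:M - E *m E^T) + E *m E^T).
Proof.
move=> EE; move defQ: (1%:M - _) => Q.
have EQ : E^T *m Q = 0 by rewrite -defQ mulmxBr mulmx1 mulmxA EE mul1mx subrr.
(* Subtract the rows and columns of the originals from those of their twins. *)
transitivity (\det (block_mx S E (- E^T) 0)).
  rewrite -(det_mulmx_ulblock (- E^T)) -(det_mulmxr_uublock (- E)).
  rewrite !mulmx_blockE !(mulNmx, mulmxN) mulmxDr EE !mulmxA !addKr mulNmx EE.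
  by rewrite opprK opprD addrAC addNr sub0r subrr.
(* The blocks [E] and [- E^T] now serve as pivots: they clear the rows and columns of the twinned
   vertices in [S], leaving [E *m E^T] there. *)
rewrite -(det_mulmx_uublock (S *m E)).
rewrite -(det_mulmxr_ulblock (E^T - E^T *m S *m Q)) !mulmx_blockE.
rewrite -(det_mulmx_ulblock E^T) !mulmx_blockE EE.
set N := (_ + E *m _).
have -> : N = Q *m S *m Q + E *m E^T.
  have SQ : S *m Q = S + S *m E *m - E^T.
    by rewrite -defQ mulmxBr mulmx1 mulmxN mulmxA.
  rewrite /N -SQ mulmxBr !mulmxA addrA.
  rewrite [in RHS](_ : Q *m S = S - E *m E^T *m S); last first.
    by rewrite -defQ mulmxBl mul1mx.
  by rewrite [in RHS]mulmxBl addrAC.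
rewrite mulmxDr !mulmxA EE EQ !(mul0mx, mul1mx) add0r subrr det_ublock det1.
by rewrite mulr1.
Qed.

(** In the orthonormal basis formed by the columns of [F] and [E], the right-hand matrix of
    [det_twin] is block diagonal, with blocks [F^T *m S *m F] and the identity. *)
Lemma det_twin_compl n m k (S : 'M[R]_n) (F : 'M[R]_(n, m)) (E : 'M[R]_(n, k)) :
    n = (m + k)%N -> F^T *m F = 1%:M -> E^T *m E = 1%:M -> F^T *m E = 0 ->
  \det (block_mx S (S *m E + E) (E^T *m S - E^T) (E^T *m S *m E)) =
  \det (F^T *m S *m F).
Proof.
move=> nmk FF EE FE.
have EF : E^T *m F = 0 by apply: trmx_inj; rewrite trmx_mul trmxK trmx0.
rewrite det_twin // -(@det_congr _ (m + k) _ (row_mx F E)) //; last first.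
  by rewrite tr_row_mx mul_col_row FF EE FE EF -scalar_mx_block.
move defQ: (1%:M - _) => Q.
have FQ : F^T *m Q = F^T by rewrite -defQ mulmxBr mulmx1 mulmxA FE mul0mx subr0.
have EQ : E^T *m Q = 0 by rewrite -defQ mulmxBr mulmx1 mulmxA EE mul1mx subrr.
have QF : Q *m F = F by rewrite -defQ mulmxBl mul1mx -mulmxA EF mulmx0 subr0.
have QE : Q *m E = 0 by rewrite -defQ mulmxBl mul1mx -mulmxA EE mulmx1 subrr.
rewrite tr_row_mx mul_col_mx mul_col_row !mulmxDr !mulmxA FQ EQ FE EE.
rewrite !(mul0mx, mul1mx, mulmxDl, add0r, addr0) -!mulmxA QF QE EE EF !mulmx0.
by rewrite det_ublock det1 mulr1.
Qed.

Definition transitive_mx m : 'M[R]_m :=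
  \matrix_(i, j) if (i < j)%N then 1 else if (j < i)%N then -1 else 0.

(* The first two vertices are twins, so they can be cleared from all the other
   rows at once. *)
Lemma det_transitive_mx m : \det (transitive_mx m.*2) = 1.
Proof.
elim: m => [|m IH]; first exact: det_mx00.
rewrite (_ : m.+1.*2 = 2 + m.*2)%N //.
have -> : transitive_mx (2 + m.*2) =
    block_mx (transitive_mx 2) (const_mx 1)
             (const_mx (-1)) (transitive_mx m.*2).
  apply/matrixP=> i j; rewrite -[i]splitK -[j]splitK.
  case: (split i) => i'; case: (split j) => j' /=.
  - by rewrite block_mxEul !mxE.
  - by rewrite block_mxEur !mxE /= ltn_addr.
  - by rewrite block_mxEdl !mxE /= ltnNge ltnW /= ltn_addr.
  - by rewrite block_mxEdr !mxE /= !ltn_add2l.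
(* The first row minus the second is [1, 1, 0, ..., 0]; added to each later row, it cancels the two
   leading entries [-1]. *)
rewrite -(det_mulmx_ulblock (\matrix_(i, j) (-1) ^+ j)) !mulmx_blockE.
set Z := (_ + const_mx (-1)); set Y := (_ + transitive_mx m.*2).
have -> : Z = 0.
  apply/matrixP=> i j; rewrite !mxE !big_ord_recl big_ord0 !mxE /=.
  case: j => [[|[|//]]] ?; rewrite /= ?(mulr0, mulr1, mulrN1, expr1, opprK).
    by rewrite add0r addr0 subrr.
  by rewrite !addr0 subrr.
have -> : Y = transitive_mx m.*2.
  apply/matrixP=> i j; rewrite !mxE !big_ord_recl big_ord0 !mxE /=.
  by rewrite !mulr1 addr0 subrr add0r.
rewrite det_ublock IH mulr1 (expand_det_row _ ord0) !big_ord_recl big_ord0.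
rewrite !mxE /=.
by rewrite /cofactor !det_mx11 !mxE /= mul0r add0r addr0 mul1r expr1 mulrN1 opprK.
Qed.

End Determinants.

(** * Selection matrices, which turn taking a principal submatrix into a congruence *)

Section Selection.
Local Open Scope ring_scope.

Definition sel_mx m n (f : 'I_m -> 'I_n) : 'M[int]_(n, m) := colsub f 1%:M.

Lemma mulmx_sel p m n (A : 'M_(p, n)) (f : 'I_m -> 'I_n) :
  A *m sel_mx f = colsub f A.
Proof. by rewrite mulmx_colsub mulmx1. Qed.

Lemma mul_tr_sel_mx p m n (A : 'M_(n, p)) (f : 'I_m -> 'I_n) :
  (sel_mx f)^T *m A = rowsub f A.
Proof. by rewrite trmx_mxsub trmx1 mul_rowsub_mx mul1mx. Qed.

Lemma sel_mx_orthonormal m n (f : 'I_m -> 'I_n) :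
  injective f -> (sel_mx f)^T *m sel_mx f = 1%:M.
Proof.
by move=> injf; rewrite mul_tr_sel_mx; apply/matrixP=> i j; rewrite !mxE inj_eq.
Qed.

Lemma sel_mx_orthogonal m p n (f : 'I_m -> 'I_n) (g : 'I_p -> 'I_n) :
  (forall i j, f i != g j) -> (sel_mx f)^T *m sel_mx g = 0.
Proof.
move=> fg; rewrite mul_tr_sel_mx; apply/matrixP=> i j.
by rewrite !mxE (negPf (fg i j)).
Qed.

End Selection.

(** * The tournament with twins and its skew-adjacency matrix *)

Section Twins.
Variables (n : nat) (T : tournament n) (X : {set 'I_n}).

Definition untwin (a : 'I_(n + #|X|)) : 'I_n :=
  match split a with inl i => i | inr j => enum_val j end.

(** Copies of one vertex are ordered by index, so an original dominates its twin. *)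
Definition twin_rel : rel 'I_(n + #|X|) :=
  fun a b => T (untwin a) (untwin b) || (untwin a == untwin b) && (a < b).

Lemma twin_irr : irreflexive twin_rel.
Proof. by move=> a; rewrite /twin_rel dominates_irr ltnn andbF. Qed.

Lemma twin_xor a b : a != b -> twin_rel a b = ~~ twin_rel b a.
Proof.
rewrite /twin_rel [untwin b == _]eq_sym => neq_ab.
case: (eqVneq (untwin a)) => [->|nab]; last by rewrite !orbF dominates_xor.
by rewrite !dominates_irr /= -leqNgt ltn_neqAle neq_ab.
Qed.

Definition twin : tournament (n + #|X|) := Tournament twin_irr twin_xor.

Lemma untwin_lshift i : untwin (lshift _ i) = i.
Proof. by rewrite /untwin (unsplitK (inl i)). Qed.

Lemma untwin_rshift j : untwin (rshift _ j) = enum_val j.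
Proof. by rewrite /untwin (unsplitK (inr j)). Qed.

Lemma contains_induced_twin : contains_induced twin T.
Proof.
exists (lshift _); first exact: lshift_inj.
move=> i j; rewrite /= /twin_rel !untwin_lshift /=.
by case: eqVneq => [->|_]; rewrite ?ltnn ?orbF.
Qed.

(** Copying rows and columns gives the products with [S]; the terms [E] and [- E^T] record the arcs
    from originals to their own twins. *)
Lemma skew_adj_twin :
  let S := skew_adj T in let E := sel_mx (@enum_val _ (mem X)) in
  (skew_adj twin =
   block_mx S (S *m E + E) (E^T *m S - E^T) (E^T *m S *m E))%R.
Proof.
move=> S E; rewrite !mulmx_sel !mul_tr_sel_mx.
apply/matrixP=> a b; rewrite -[a]splitK -[b]splitK.
case: (split a) => i; case: (split b) => j /=.
- rewrite block_mxEul !mxE /= /twin_rel !untwin_lshift /=.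
  by case: eqVneq => [->|_]; rewrite ?ltnn ?eqxx ?orbF.
- rewrite block_mxEur !mxE /= /twin_rel untwin_lshift untwin_rshift /=.
  rewrite [enum_val j == i]eq_sym ltn_addr //.
  by case: eqVneq => [->|_]; rewrite ?dominates_irr ?orbF ?addr0.
- rewrite block_mxEdl !mxE /= /twin_rel untwin_lshift untwin_rshift /=.
  rewrite [j == _]eq_sym [n + i < j]ltnNge.
  rewrite (ltnW (ltn_addr _ (ltn_ord j))) andbF.
  rewrite (ltn_addr _ (ltn_ord j)).
  by case: eqVneq => [->|_]; rewrite ?dominates_irr ?orbF ?subr0.
- rewrite block_mxEdr !mxE /= /twin_rel !untwin_rshift /= !ltn_add2l.
  rewrite !(inj_eq enum_val_inj).
  by case: eqVneq => [->|_]; rewrite ?ltnn ?eqxx ?orbF.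
Qed.

End Twins.

(** Twinning all vertices outside the image of [H] restores the determinant of [H]. *)
Lemma unimodular_extension n m (T : tournament n) (H : tournament m) :
  unimodular H -> contains_induced T H -> unimodular_by_adding T (n - m).
Proof.
move=> unimod_H [f injf fP].
pose X := ~: [set f i | i in 'I_m].
have mX : n = m + #|X|.
  have := cardsC [set f i | i in 'I_m].
  by rewrite card_imset // !card_ord => ->.
have -> : n - m = #|X| by rewrite [in LHS]mX addKn.
exists (twin T X); last exact: contains_induced_twin.
rewrite /unimodular skew_adj_twin (@det_twin_compl _ _ m _ _ (sel_mx f)) //.
- rewrite mul_tr_sel_mx mulmx_sel -[RHS]unimod_H; congr (\det _)%R.
  by apply/matrixP=> i j; rewrite !mxE !fP.
- exact: sel_mx_orthonormal.
- exact/sel_mx_orthonormal/enum_val_inj.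
- apply: sel_mx_orthogonal => i j; apply: contraTneq (enum_valP j) => <-.
  by rewrite inE negbK imset_f.
Qed.

Lemma unimodular_removing_adding n (T : tournament n) k :
  unimodular_by_removing T k -> unimodular_by_adding T k.
Proof.
move=> [X <- unimod_X].
have -> : #|X| = n - #|~: X|.
  exact: canRL (addnK _) (etrans (cardsC X) (card_ord n)).
apply: unimodular_extension unimod_X _.
by exists enum_val => //; exact: enum_val_inj.
Qed.

(** The order is a variable because [#|~: setT|] is only provably zero. *)
Lemma unimodular_order0 n (T : tournament n) : n = 0 -> unimodular T.
Proof. by move=> n0; subst n; apply: det_mx00. Qed.

(** * Transitive subtournaments of logarithmic order *)

Definition transitive_tournament m : tournament m :=
  @Tournament m (fun i j => i < j) (fun i => ltnn i)
    (fun i j ij => etrans (ltn_neqAle i j)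
      (etrans (congr1 (andb^~ (i <= j)) ij) (leqNgt i j))).

Lemma unimodular_transitive m : unimodular (transitive_tournament m.*2).
Proof. exact: det_transitive_mx. Qed.

(** Of the at least [2 ^ k.+1 - 1] other vertices of [A], at least [2 ^ k] lie on one side of [x],
    which is then put before or after a chain found there. *)
Lemma transitive_chain n (T : tournament n) k (A : {set 'I_n}) :
  2 ^ k <= #|A| ->
  exists s : seq 'I_n, [/\ size s = k.+1, {subset s <= A} & pairwise T s].
Proof.
elim: k A => [|k IH] A leA.
  have /card_gt0P[x Ax] := leA.
  by exists [:: x]; split=> // y; rewrite inE => /eqP->.
have /card_gt0P[x Ax] : 0 < #|A| by apply: leq_trans leA; rewrite expn_gt0.
pose B := [set y in A | T x y]; pose C := [set y in A | T y x].
have subA : A :\ x \subset B :|: C.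
  apply/subsetP=> y; rewrite !inE => /andP[nyx ->].
  by rewrite (dominates_xor T nyx) orbN.
have [/IH[s [sz sB Ts]]|ltB] := leqP (2 ^ k) #|B|.
  exists (x :: s); split; first by rewrite /= sz.
    by move=> y; rewrite inE => /predU1P[->//|/sB]; rewrite inE => /andP[].
  by rewrite /= Ts andbT; apply/allP=> y /sB; rewrite inE => /andP[].
have /IH[s [sz sC Ts]] : 2 ^ k <= #|C|.
  rewrite -(leq_add2l (2 ^ k)) addnn -mul2n -expnS (leq_trans leA) //.
  rewrite (cardsD1 x) Ax (leq_trans _ (leq_add ltB (leqnn _))) // addSn ltnS.
  exact: leq_trans (subset_leq_card subA) (leq_card_setU B C).
exists (rcons s x); split; first by rewrite size_rcons sz.
  move=> y; rewrite mem_rcons inE => /predU1P[->//|/sC].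
  by rewrite inE => /andP[].
by rewrite pairwise_rcons Ts andbT; apply/allP=> y /sC; rewrite inE => /andP[].
Qed.

Lemma contains_transitive n (T : tournament n) m :
  0 < n -> m <= (trunc_log 2 n).+1 ->
  contains_induced T (transitive_tournament m).
Proof.
move=> n_gt0 le_m.
have [] := @transitive_chain _ T (trunc_log 2 n) setT.
  by rewrite cardsT card_ord trunc_logP.
move=> s [sz _ /(pairwiseP (Ordinal n_gt0)) Ts].
(* The default is never reached, as [m] is at most the size of [s]. *)
pose f (i : 'I_m) := nth (Ordinal n_gt0) s i.
have Tf (i j : 'I_m) : i < j -> T (f i) (f j).
  by apply: Ts; rewrite inE sz (leq_trans (ltn_ord _) le_m).
have fE i j : T (f i) (f j) = (i < j).
  case: (ltngtP i j) => [/Tf->//|ltji|/ord_inj->]; last first.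
    by rewrite dominates_irr.
  have Tji := Tf _ _ ltji.
  rewrite dominates_xor ?Tji //; apply: contraTneq Tji => ->.
  by rewrite dominates_irr.
exists f; last exact: fE.
move=> i j fij; case: (ltngtP i j) => [/Tf|/Tf|/ord_inj//];
  by rewrite fij dominates_irr.
Qed.

Theorem theorem5p1 (n : nat) (T : tournament n) (n_gt0 : 0 < n) :
  exists up um : nat,
    [/\ is_u_plus T up, is_u_minus T um, up <= um
      & up <= n - trunc_log 2 n].
Proof.
have [um [um_ok um_min]] : exists um, is_u_minus T um.
  (* Removing every vertex leaves the empty tournament, which is unimodular. *)
  apply: (@is_least_exists _ n); exists setT; first by rewrite cardsT card_ord.
  by apply: unimodular_order0; rewrite setCT cards0.
have [up [up_ok up_min]] : exists up, is_u_plus T up.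
  exact: is_least_exists (unimodular_removing_adding um_ok).
exists up, um; split=> //; first exact/up_min/unimodular_removing_adding.
(* [m.*2] is the even one among [trunc_log 2 n] and its successor. *)
pose m := uphalf (trunc_log 2 n).
have /andP[m_ge m_le] : trunc_log 2 n <= m.*2 <= (trunc_log 2 n).+1.
  by rewrite -leq_uphalf_double -geq_uphalf_double leqnn.
apply: leq_trans (up_min _ _) (leq_sub2l n m_ge).
apply: unimodular_extension (unimodular_transitive m) _.
exact: contains_transitive.
Qed.
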